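(* Let $n \geq 3$ and let $A$ and $B$ be two real $n \times n$ symmetric matrices. Suppose there is a hypomorphism $\Sigma$ with $B = \Sigma(A)$. Then there exists a nonempty open interval $T \subset \mathbb R$ such that for every $t \in T$: (1) $\lambda_n(A + tJ) = \lambda_n(B + tJ)$; (2) the eigenspaces of $A+tJ$ and of $B+tJ$ for their respective lowest eigenvalues $\lambda_n$ are both one dimensional; (3) these lowest eigenspaces coincide: $\mathrm{eigen}_{\lambda_n}(A + tJ) = \mathrm{eigen}_{\lambda_n}(B + tJ)$.
   Context: For an $n\times n$ matrix $M$, $M_i$ denotes the $(n-1)\times(n-1)$ matrix obtained by deleting the $i$-th row and $i$-th column. Two $n\times n$ real symmetric matrices $A,B$ are hypomorphic, written $B=\Sigma(A)$, if there exist $(n-1)\times(n-1)$ permutation matrices $\sigma_1,\dots,\sigma_n$ with $B_i=\sigma_i A_i\sigma_i^t$ for every $i$; $\Sigma=\{\sigma_1,\dots,\sigma_n\}$ is called a hypomorphism. For a real symmetric $M$ with eigenvalues $\lambda_1(M)\ge\dots\ge\lambda_n(M)$, $\mathrm{eigen}_\alpha(M)$ denotes the eigenspace of the eigenvalue $\alpha$. $\mathbf 1=(1,\dots,1)$ is the $n$-dimensional row vector of ones and $J=\mathbf 1^t\mathbf 1$ is the all-ones $n\times n$ matrix. *)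

(* Defs.v *)
From HB Require Import structures.
From mathcomp Require Import all_boot all_order all_algebra.
From mathcomp Require Import polyrcf.
From mathcomp Require Import reals.
From mathcomp Require Import complex spectral.

Set Implicit Arguments.
Unset Strict Implicit.
Unset Printing Implicit Defensive.

Import Order.TTheory GRing.Theory Num.Theory.
Local Open Scope ring_scope.

Definition del_rc (R : Type) (n : nat) (i : 'I_n) (M : 'M[R]_n) : 'M[R]_n.-1 :=
  row' i (col' i M).

Definition hypomorphism (R : realType) (n : nat)
    (Sigma : 'I_n -> 'M[R]_n.-1) (A B : 'M[R]_n) : Prop :=
  forall i : 'I_n, is_perm_mx (Sigma i) /\
    del_rc i B = Sigma i *m del_rc i A *m (Sigma i)^T.

(* The real eigenvalues of M listed in nonincreasing order, each repeated
   according to its multiplicity as a root of the characteristic polynomial. *)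
Definition eigenvalues (R : realType) (n : nat) (M : 'M[R]_n) : seq R :=
  sort >=%R
    (flatten [seq nseq (mup x (char_poly M)) x | x <- rootsR (char_poly M)]).

(* The k-th largest eigenvalue, indexed from 1. *)
Definition lambda (R : realType) (n : nat) (M : 'M[R]_n) (k : nat) : R :=
  nth 0 (eigenvalues M) k.-1.

Definition J (R : realType) (n : nat) : 'M[R]_n := const_mx 1.

Lemma rootsR_uniq_mem (R : rcfType) (p : {poly R}) : p != 0 ->
  uniq (rootsR p) /\ (forall x, (x \in rootsR p) = root p x).
Proof.
move=> p0; split.
  have := sorted_roots (- cauchy_bound p) (cauchy_bound p) p.
  exact: lt_sorted_uniq.
by move=> x; rewrite -(roots_on_rootsR p0 x) in_itv.
Qed.

Lemma count_eigenvalues (R : realType) n (M : 'M[R]_n) x :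
  count_mem x (eigenvalues M) = mup x (char_poly M).
Proof.
have p0 : char_poly M != 0 by rewrite monic_neq0 ?char_poly_monic.
have [u m] := rootsR_uniq_mem p0.
have /permP -> : perm_eq (eigenvalues M)
    (flatten [seq nseq (mup y (char_poly M)) y | y <- rootsR (char_poly M)]).
  by rewrite perm_sort.
rewrite count_flatten -map_comp sumnE big_map.
under eq_bigr => y _ do rewrite /= count_nseq /=.
have [rx|nrx] := boolP (root (char_poly M) x).
  rewrite (bigD1_seq x) ?m //= eqxx mul1n big1 ?addn0 // => y /negPf yx.
  by rewrite yx.
rewrite big1_seq; last first.
  move=> y /andP[_]; rewrite m => ry; case: eqP => // E; by rewrite -E ry in nrx.
by rewrite mupNroot.
Qed.

Lemma sorted_eigenvalues (R : realType) n (M : 'M[R]_n) :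
  sorted (fun x y => y <= x) (eigenvalues M).
Proof. by apply: sort_sorted => x y; rewrite le_total. Qed.

Lemma mem_eigenvalues (R : realType) n (M : 'M[R]_n) x :
  (x \in eigenvalues M) = eigenvalue M x.
Proof.
have p0 : char_poly M != 0 by rewrite monic_neq0 ?char_poly_monic.
rewrite eigenvalue_root_char root_factor_theorem XsubC_dvd //.
by rewrite -count_eigenvalues -has_count has_pred1.
Qed.

Lemma char_poly_simC (C : numClosedFieldType) n (P D : 'M[C]_n) :
  P \in unitmx ->
  char_poly (invmx P *m D *m P) = char_poly D.
Proof.
move=> Pu; rewrite /char_poly.
pose Q := map_mx (@polyC C) P.
have Qu : Q \in unitmx by rewrite /Q map_unitmx.
have -> : char_poly_mx (invmx P *m D *m P) = invmx Q *m char_poly_mx D *m Q.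
  rewrite /char_poly_mx !map_mxM /= mulmxBr mulmxBl -/Q.
  rewrite scalar_mxC -(mulmxA _%:M) mulVmx // mulmx1; congr (_ - _ *m _ *m _).
  by rewrite map_invmx.
rewrite !det_mulmx det_inv mulrAC mulVr ?mul1r //.
Qed.

Lemma char_poly_eigenvalues (R : realType) n (M : 'M[R]_n) :
  M \is symmetricmx ->
  char_poly M = \prod_(x <- eigenvalues M) ('X - x%:P).
Proof.
move=> Ms.
pose f := real_complex R.
pose MC := map_mx f M.
have hMC : MC \is hermsymmx.
  apply/is_hermitianmxP; rewrite expr0 scale1r; apply/matrixP => i j.
  rewrite !mxE; have /is_hermitianmxP := Ms.
  rewrite expr0 scale1r => /matrixP /(_ i j).
  by rewrite !mxE /= => ->; rewrite conj_Creal ?complex_real//.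
have /orthomx_spectralP eM := hermitian_normalmx hMC.
have dr := hermitian_spectral_diag_real hMC.
have cp : char_poly MC = \prod_i ('X - ((spectral_diag MC) 0 i)%:P).
  rewrite eM char_poly_simC ?spectral_unit // char_poly_trig ?diag_mx_is_trig //.
  by rewrite -eM; apply: eq_bigr => i _; rewrite mxE eqxx mulr1n.
pose r := [seq complex.Re (spectral_diag MC 0 i) | i <- index_enum 'I_n].
have cr : char_poly M = \prod_(x <- r) ('X - x%:P).
  apply: (map_poly_inj f); rewrite map_char_poly cp rmorph_prod /= big_map.
  apply: eq_bigr => i _; rewrite rmorphB /= map_polyX map_polyC /=.
  have /mxOverP /(_ 0 i) hr := dr; congr (_ - _%:P).
  by apply/esym; rewrite /f RRe_real.
have pe : perm_eq r (eigenvalues M).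
  by apply/allP => x _; rewrite /= count_eigenvalues cr mu_prod_XsubC.
by rewrite cr; apply: perm_big.
Qed.

Lemma size_eigenvalues (R : realType) n (M : 'M[R]_n) : M \is symmetricmx ->
  size (eigenvalues M) = n.
Proof.
move=> /char_poly_eigenvalues /(congr1 (size \o polyseq)) /=.
by rewrite size_char_poly size_prod_XsubC => -[].
Qed.

(* Main.v *)
Require Import Defs.
From mathcomp Require Import all_boot all_order all_algebra.
From mathcomp Require Import reals.
From mathcomp Require Import perm polyorder polyrcf.
From mathcomp Require Import ring lra zify.

(* Put M = 'X - A, u = adj(M) 1 (a vector of polynomials, [adj_ones A] below),
   a = det M and p = det (M + J) = a + sum_i u_i. For symmetric A one has
   a adj(M + J) = p adj(M) - u u^t; on the diagonal this is
   u_i^2 = p a_i - a q_i, where a_i and q_i are the characteristic polynomials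
   of A_i and (A - J)_i, hence common to A and B. As a' = sum_i a_i, the
   polynomials a of A and B differ by a constant g, and likewise the p by d.
   Each u_i is monic of degree n - 1, so factoring u_i(A)^2 - u_i(B)^2 =
   d a_i - g q_i forces u_i(A) - u_i(B) = (d - g) / 2; summing over i gives
   n (d - g) / 2 = d - g, so d = g as n <> 2, and then d = g = 0. Thus a and u
   agree for A and B. Whenever l is an eigenvalue of A + t J but not of A, its
   eigenspace is spanned by u(l)^t; the lowest eigenvalue of A + t J, being at
   most t + tr A / n, is of this kind for all very negative t. *)

Set Implicit Arguments.
Unset Strict Implicit.
Unset Printing Implicit Defensive.

Import Order.TTheory GRing.Theory Num.Theory.
Local Open Scope ring_scope.

(** * Rank-one updates of determinants and adjugates *)

(** Block elimination on the bordered matrix [S], once from the left and once from the right; using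
    [\adj M] instead of an inverse costs a factor [\det M], cancelled at the end. *)
Lemma det_add_rank1 (K : idomainType) n (M : 'M[K]_n) (c : 'cV_n) (r : 'rV_n) :
  \det M != 0 -> \det (M + c *m r) = \det M + (r *m \adj M *m c) 0 0.
Proof.
move=> M0; pose S := block_mx (1%:M : 'M_1) (- r) c M.
have detS : \det S = \det (M + c *m r).
  have : block_mx (1%:M : 'M_1) 0 (- c) 1%:M *m S
       = block_mx 1%:M (- r) 0 (M + c *m r).
    rewrite mulmx_block !mul1mx !mul0mx !addr0 mulmx1 addNr.
    by rewrite mulNmx mulmxN opprK addrC.
  move/(congr1 determinant).
  by rewrite det_mulmx det_lblock det_ublock !det1 !mul1r.
have : S *m block_mx (\det M)%:M 0 (- (\adj M *m c)) 1%:M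
     = block_mx ((\det M)%:M + r *m (\adj M *m c)) (- r) 0 M.
  rewrite mulmx_block !mul1mx !mulmx0 !mulmx1 !add0r mulNmx !mulmxN opprK.
  by rewrite (mulmxA M) mul_mx_adj mul_scalar_mx mul_mx_scalar subrr.
move/(congr1 determinant).
rewrite det_mulmx det_lblock det_ublock det1 mulr1 detS !det_mx11.
rewrite ![((_ + _ : 'M_1) 0 0)]mxE ![_%:M 0 0]mxE eqxx mulr1n.
by rewrite -mulmxA => /(mulIf M0).
Qed.

(** The vector [u] also equals [\adj N *m c], so by symmetry [u^T = c^T *m \adj N]; then expand
    [\adj M *m M *m \adj N] with [M = N - c *m c^T]. *)
Lemma adj_add_rank1 (K : idomainType) n (M : 'M[K]_n) (c : 'cV_n) :
  M^T = M -> \det M != 0 -> \det (M + c *m c^T) != 0 ->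
  \det M *: \adj (M + c *m c^T)
    = \det (M + c *m c^T) *: \adj M - (\adj M *m c) *m (\adj M *m c)^T.
Proof.
set N := M + _; set u := \adj M *m c => Msym M0 N0.
have Nsym : N^T = N by rewrite linearD /= trmx_mul trmxK Msym.
have Nu : N *m u = \det N *: c.
  rewrite mulmxDl -[c *m _ *m _]mulmxA [c^T *m u]mx11_scalar mul_mx_scalar.
  by rewrite mulmxA mul_mx_adj mul_scalar_mx -scalerDl det_add_rank1 // -mulmxA.
have uE : u = \adj N *m c.
  have /matrixP E : \det N *: u = \det N *: (\adj N *m c).
    by rewrite [RHS]scalemxAr -Nu mulmxA mul_adj_mx mul_scalar_mx.
  by apply/matrixP => i j; apply: (mulfI N0); have := E i j; rewrite !mxE.
have uTE : u^T = c^T *m \adj N by rewrite uE trmx_mul trmx_adj Nsym.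
rewrite -mul_scalar_mx -mul_adj_mx -mulmxA.
have -> : M *m \adj N = (\det N)%:M - c *m u^T.
  by rewrite -mul_mx_adj mulmxDl uTE mulmxA addrK.
by rewrite mulmxBr mul_mx_scalar mulmxA.
Qed.

(** * Derivative of the characteristic polynomial *)

Lemma deriv_prod (K : comNzRingType) (I : eqType) (r : seq I) (F : I -> {poly K}) :
  uniq r ->
  (\prod_(i <- r) F i)^`()
    = \sum_(i <- r) (F i)^`() * \prod_(j <- r | j != i) F j.
Proof.
elim: r => [|i r IH] /=; first by rewrite !big_nil derivC.
case/andP=> ir ur; rewrite !big_cons derivM IH // eqxx.
congr (_ * _ + _).
  rewrite -[RHS]big_filter; congr bigop; apply/esym/all_filterP/allP => j jr /=.
  by apply: contraNneq ir => <-.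
rewrite mulr_sumr; apply: eq_big_seq => j jr.
rewrite big_cons; case: eqVneq => [E|_]; first by rewrite E jr in ir.
by rewrite mulrCA.
Qed.

Lemma deriv_char_poly (K : comNzRingType) n (A : 'M[K]_n) :
  (char_poly A)^`() = \sum_i char_poly (row' i (col' i A)).
Proof.
pose M := char_poly_mx A.
(* [D i] is [M] with row [i] differentiated entrywise; by the Leibniz formula the derivative of
   [\det M] is the sum of the [\det (D i)]. *)
pose D i : 'M_n := \matrix_(j, k) if j == i then (i == k)%:R else M j k.
have detD i : \det (D i) = char_poly (row' i (col' i A)).
  rewrite (expand_det_row _ i) (bigD1 i) //= big1 => [|k ki].
    rewrite addr0 !mxE !eqxx mul1r /cofactor addnn -signr_odd odd_double mul1r.
    rewrite /char_poly; congr determinant; apply/matrixP => j k.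
    by rewrite !mxE /= eq_sym (negPf (neq_lift _ _)) !(inj_eq lift_inj).
  by rewrite mxE eqxx eq_sym (negPf ki) mul0r.
under eq_bigr => i _ do rewrite -detD.
rewrite /char_poly /determinant raddf_sum /= exchange_big /=.
apply: eq_bigr => s _; rewrite raddfMsign /= deriv_prod ?index_enum_uniq //.
rewrite mulr_sumr; apply: eq_bigr => i _; rewrite [in RHS](bigD1 i) //= !mxE eqxx.
congr (_ * (_ * _)).
  by rewrite derivB derivMn derivX derivC subr0.
by apply: eq_bigr => j ji; rewrite [in RHS]mxE (negPf ji).
Qed.

(** * The polynomial vector [adj_ones]: identities, degree, leading coefficient *)

Definition adj_ones (R : comNzRingType) n (A : 'M[R]_n) : 'cV[{poly R}]_n :=
  \adj (char_poly_mx A) *m const_mx 1.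

Lemma char_poly_mx_adj_ones (R : comNzRingType) n (A : 'M[R]_n) :
  char_poly_mx A *m adj_ones A = char_poly A *: const_mx 1.
Proof. by rewrite mulmxA mul_mx_adj mul_scalar_mx. Qed.

Lemma char_poly_neq0 (R : nzRingType) n (A : 'M[R]_n) : char_poly A != 0.
Proof. by rewrite monic_neq0 ?char_poly_monic. Qed.

Lemma char_poly_add_ones (R : idomainType) n (A : 'M[R]_n) t :
  char_poly (A + t *: const_mx 1) = char_poly A - t *: \sum_i adj_ones A i 0.
Proof.
have -> : char_poly (A + t *: const_mx 1) = \det (char_poly_mx A +
    ((- t)%:P *: const_mx 1 : 'cV_n) *m (const_mx 1 : 'rV_n)).
  rewrite /char_poly; congr determinant; apply/matrixP => i j.
  by rewrite !mxE big_ord1 !mxE !mulr1 polyCD polyCN opprD addrA.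
rewrite det_add_rank1 ?char_poly_neq0 //; congr (_ + _).
rewrite -mulmxA -!scalemxAr -/(adj_ones A) mxE -scaleNr -mul_polyC mxE.
by congr (_ * _); apply: eq_bigr => i _; rewrite mxE mul1r.
Qed.

Lemma adj_char_poly_mx_diag (R : comNzRingType) n (A : 'M[R]_n) i :
  \adj (char_poly_mx A) i i = char_poly (row' i (col' i A)).
Proof.
rewrite mxE /cofactor addnn -signr_odd odd_double mul1r.
rewrite /char_poly; congr determinant; apply/matrixP => j k.
by rewrite !mxE (inj_eq lift_inj).
Qed.

(** Diagonal entry of [adj_add_rank1] for the all-ones column, as ['X - (A - J)] is
    [('X - A) + J]. *)
Lemma sqr_adj_ones (R : idomainType) n (A : 'M[R]_n) i : A^T = A ->
  adj_ones A i 0 ^+ 2 =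
    char_poly (A - const_mx 1) * char_poly (row' i (col' i A))
    - char_poly A * char_poly (row' i (col' i (A - const_mx 1))).
Proof.
move=> Asym; pose M := char_poly_mx A; pose c : 'cV[{poly R}]_n := const_mx 1.
have NE : char_poly_mx (A - const_mx 1) = M + c *m c^T.
  apply/matrixP => j k; rewrite !mxE big_ord1 !mxE mulr1 polyCB opprB.
  by rewrite polyC1 addrCA addrC.
have Msym : M^T = M.
  by rewrite /M /char_poly_mx linearB /= tr_scalar_mx map_trmx Asym.
have := @adj_add_rank1 _ _ M c Msym.
rewrite -NE !char_poly_neq0 => /(_ isT isT) /matrixP /(_ i i).
rewrite [LHS]mxE [RHS]mxE [X in _ = X + _]mxE [X in _ = _ + X]mxE.
rewrite [X in _ = _ - X]mxE big_ord1 [_^T _ _]mxE.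
rewrite !adj_char_poly_mx_diag -/(adj_ones A) -expr2 => ->.
by rewrite opprB addrC subrK.
Qed.

Lemma mulX_adj_ones (R : comNzRingType) n (A : 'M[R]_n) i :
  'X * adj_ones A i 0 = char_poly A + \sum_k (A i k)%:P * adj_ones A k 0.
Proof.
have /matrixP/(_ i 0) := char_poly_mx_adj_ones A; move: (adj_ones A) => u.
rewrite /char_poly_mx mulmxBl mul_scalar_mx !mxE mulr1.
move/eqP; rewrite subr_eq => /eqP ->; congr (_ + _).
by apply: eq_bigr => k _; rewrite mxE.
Qed.

Lemma size_adj_ones (R : idomainType) n (A : 'M[R]_n) i :
  (size (adj_ones A i 0)%R <= n)%N.
Proof.
(* If the longest entry of u were longer than n, then in ['X * u j = char_poly A
   + ...] ([mulX_adj_ones]) the left side would be longer than the right. *)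
set u := adj_ones A.
have [j _ jmax] := @arg_maxnP _ i xpredT (fun j => size (u j 0)) isT.
apply: leq_trans (jmax i isT) _; rewrite leqNgt; apply/negP => lt_n.
have u0 : u j 0 != 0 by rewrite -size_poly_gt0; lia.
have := congr1 (size \o polyseq) (mulX_adj_ones A j).
rewrite /= -/u mulrC size_mulX // => E.
have : (size (char_poly A + \sum_k (A j k)%:P * u k 0)%R <= size (u j 0)%R)%N.
  apply: leq_trans (size_polyD _ _) _; rewrite geq_max size_char_poly lt_n /=.
  apply: leq_trans (size_sum _ _ _) _; apply/bigmax_leqP => k _.
  by rewrite mul_polyC; apply: leq_trans (size_scale_leq _ _) (jmax k isT).
by rewrite -E ltnn.
Qed.

Lemma coef_char_poly_lead (R : nzRingType) n (A : 'M[R]_n) :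
  (char_poly A)`_n = 1.
Proof.
by have /monicP := char_poly_monic A; rewrite lead_coefE size_char_poly.
Qed.

(** Compare coefficients of ['X^n] in [mulX_adj_ones]: by [size_adj_ones] the sum contributes
    nothing there. *)
Lemma lead_adj_ones (R : idomainType) n (A : 'M[R]_n) i :
  (adj_ones A i 0)`_n.-1 = 1.
Proof.
have n0 : (0 < n)%N by case: n A i => [|//] A [].
have := congr1 (fun p : {poly R} => p`_n) (mulX_adj_ones A i).
rewrite coefXM (gtn_eqF n0) coefD coef_char_poly_lead coef_sum big1 ?addr0 //.
by move=> k _; rewrite coefCM nth_default ?mulr0 ?size_adj_ones.
Qed.

(** * What the decks of A and A - J determine *)

Lemma deriv_inj_const (R : realDomainType) (p q : {poly R}) :
  p^`() = q^`() -> exists c, p - q = c%:P.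
Proof.
move=> dpq; have : size (p - q)^`() = 0%N by rewrite derivB dpq subrr size_poly0.
rewrite size_deriv => s0; exists (p - q)`_0; apply: size1_polyC.
by case: size s0 => [|[]].
Qed.

Lemma char_poly_deck_const (R : realDomainType) n (A B : 'M[R]_n) :
  (forall i, char_poly (row' i (col' i A)) = char_poly (row' i (col' i B))) ->
  exists c, char_poly A - char_poly B = c%:P.
Proof.
by move=> AB; apply: deriv_inj_const; rewrite !deriv_char_poly; apply: eq_bigr.
Qed.

Lemma deck_char_poly_adj_ones (R : realFieldType) n (A B : 'M[R]_n) :
  (3 <= n)%N -> A^T = A -> B^T = B ->
  (forall i, char_poly (row' i (col' i A)) = char_poly (row' i (col' i B))) ->
  (forall i, char_poly (row' i (col' i (A - const_mx 1)))
           = char_poly (row' i (col' i (B - const_mx 1)))) ->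
  char_poly A = char_poly B /\ adj_ones A = adj_ones B.
Proof.
move=> n3 Asym Bsym dA dAJ.
have [g gE] := char_poly_deck_const dA.
have [d dE] := char_poly_deck_const dAJ.
have diff i : exists2 k, adj_ones A i 0 - adj_ones B i 0 = k%:P & k * 2 = d - g.
  set x := adj_ones A i 0; set y := adj_ones B i 0.
  have xyE : (x - y) * (x + y) = d%:P * char_poly (row' i (col' i A))
                       - g%:P * char_poly (row' i (col' i (A - const_mx 1))).
    rewrite -subr_sqr /x /y !sqr_adj_ones // -dA -dAJ -gE -dE; ring.
  have coefxy : (x + y)`_n.-1 = 2.
    by rewrite coefD /x /y !lead_adj_ones.
  have sxy : size (x + y) = n.
    apply/eqP; rewrite eqn_leq; apply/andP; split.
      apply: leq_trans (size_polyD _ _) _.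
      by rewrite geq_max !size_adj_ones.
    rewrite leqNgt; apply/negP => lt.
    have := coefxy; rewrite nth_default; last by rewrite -ltnS (ltn_predK n3).
    by move/esym/eqP; rewrite pnatr_eq0.
  (* Cards have characteristic polynomials of degree n - 1, which is also the degree of [x + y];
     hence [x - y] is constant. *)
  have sr : (size ((x - y) * (x + y))%R <= n)%N.
    rewrite xyE; apply: leq_trans (size_polyD _ _) _.
    rewrite size_polyN geq_max !mul_polyC.
    by apply/andP; split; apply: leq_trans (size_scale_leq _ _) _;
      rewrite size_char_poly; lia.
  have s1 : (size (x - y)%R <= 1)%N.
    have [->|xy0] := eqVneq (x - y) 0; first by rewrite size_poly0.
    have xy0' : x + y != 0 by rewrite -size_poly_gt0 sxy; lia.
    by move: sr; rewrite size_mul // sxy -subn1 leq_subLR leq_add2r.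
  have [k kE] : exists k, x - y = k%:P by exists (x - y)`_0; apply: size1_polyC.
  exists k => //.
  (* Compare coefficients of degree n - 1: [x + y] contributes 2, each monic card 1. *)
  move/(congr1 (fun p : {poly R} => p`_n.-1)): xyE.
  by rewrite /= kE coefB !coefCM coefxy !coef_char_poly_lead !mulr1.
have sumE : \sum_i adj_ones A i 0 - \sum_i adj_ones B i 0 = (d - g)%:P.
  have JE (C : 'M[R]_n) : char_poly (C - const_mx 1)
      = char_poly C + \sum_i adj_ones C i 0.
    by have := char_poly_add_ones C (-1); rewrite !scaleN1r opprK.
  rewrite polyCB -gE -dE !JE; ring.
have nE : (d - g) * n%:R = (d - g) * 2.
  apply: polyC_inj; rewrite [in RHS]polyCM -sumE -sumrB mulr_suml.
  under eq_bigr => i _ do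
    (have [k -> kE] := diff i; rewrite -polyCM kE).
  by rewrite sumr_const card_ord mulr_natr polyCMn.
have dg : d = g.
  move/eqP: nE; rewrite -subr_eq0 -mulrBr mulf_eq0 subr_eq0 => /orP[/eqP//|].
  by rewrite subr_eq0 eqr_nat => /eqP n2; rewrite n2 in n3.
have uAB i : adj_ones A i 0 = adj_ones B i 0.
  have [k kE] := diff i; rewrite dg subrr => /eqP.
  rewrite mulf_eq0 pnatr_eq0 orbF => /eqP k0.
  by apply/eqP; rewrite -subr_eq0 kE k0.
split; last by apply/matrixP => i j; rewrite ord1.
have n0 : (0 < n)%N by lia.
pose i := Ordinal n0.
have := sqr_adj_ones i Asym; rewrite uAB (sqr_adj_ones i Bsym) -dA -dAJ.
set p := char_poly (row' i (col' i A)); set q := char_poly (row' i _) => E.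
(* Since the squares agree and d = g, subtracting the two square identities leaves this. *)
have E0 : d%:P * (p - q) = 0.
  have -> : d%:P * (p - q) = d%:P * p - g%:P * q by rewrite dg; ring.
  rewrite -gE -dE; move/eqP: E; rewrite -subr_eq0 => /eqP E.
  rewrite -[RHS]oppr0 -E; ring.
apply/eqP; rewrite -subr_eq0 gE -dg polyC_eq0.
move/eqP: E0; rewrite mulf_eq0 polyC_eq0 => /orP[//|].
(* [p = q] is impossible: this coefficient is minus the trace of the card, and the cards of A and A
   - J have traces differing by n - 1. *)
rewrite subr_eq0 => /eqP /(congr1 (fun r : {poly R} => r`_n.-2)).
rewrite !char_poly_trace; try lia.
move/oppr_inj; rewrite /mxtrace => /eqP; rewrite -subr_eq0 -sumrB.
under eq_bigr => j _ do rewrite !mxE opprB addrCA subrr addr0.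
by rewrite sumr_const card_ord pnatr_eq0; lia.
Qed.

(** * Decks of A + t J under a hypomorphism *)

Lemma symmetricmxE (R : realType) n (A : 'M[R]_n) :
  A \is symmetricmx -> A^T = A.
Proof.
move/is_hermitianmxP; rewrite expr0 scale1r => {2}->.
by apply/matrixP => i j; rewrite !mxE.
Qed.

Lemma char_poly_perm_conj (R : comNzRingType) n (P A : 'M[R]_n) :
  is_perm_mx P -> char_poly (P *m A *m P^T) = char_poly A.
Proof.
case/is_perm_mxP => s ->; rewrite tr_perm_mx.
pose Q r : 'M[{poly R}]_n := perm_mx r.
have QV : Q s *m Q (s^-1)%g = 1%:M by rewrite -perm_mxM mulgV perm_mx1.
have -> : char_poly (perm_mx s *m A *m perm_mx (s^-1)%g)
    = \det (Q s *m char_poly_mx A *m Q (s^-1)%g).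
  rewrite /char_poly /char_poly_mx !map_mxM !map_perm_mx mulmxBr mulmxBl.
  by rewrite scalar_mxC -(mulmxA _%:M) QV mulmx1.
by rewrite !det_mulmx mulrAC -det_mulmx QV det1 mul1r.
Qed.

(** Conjugation by a permutation matrix fixes the all-ones matrix, so [Sigma] also relates the cards
    of A + t J and B + t J. *)
Lemma hypomorphism_char_poly (R : realType) n Sigma (A B : 'M[R]_n) t i :
  hypomorphism Sigma A B ->
  char_poly (row' i (col' i (A + t *: const_mx 1)))
    = char_poly (row' i (col' i (B + t *: const_mx 1))).
Proof.
move=> /(_ i) [sP]; rewrite /del_rc => BE.
have E (C : 'M[R]_n) : row' i (col' i (C + t *: const_mx 1))
   = row' i (col' i C) + t *: const_mx 1 by apply/matrixP => j k; rewrite !mxE.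
rewrite !E BE -(char_poly_perm_conj _ sP) mulmxDr mulmxDl -scalemxAr -scalemxAl.
congr (char_poly (_ + _ *: _)).
have /is_perm_mxP[s ->] := sP.
by rewrite tr_perm_mx -row_permE -col_permE; apply/matrixP => j k; rewrite !mxE.
Qed.

(** * Eigenspaces and the lowest eigenvalue of A + t J *)

(** The invertible matrix [l%:M - A] sends every eigenvector, and also [u], to a multiple of the
    all-ones row, the multiple for [u] being nonzero. So the eigenspace lies in the line of [u], and
    having positive rank it fills it. *)
Lemma eigenspace_add_ones (F : fieldType) n (A : 'M[F]_n) t l :
  A^T = A -> ~~ eigenvalue A l -> eigenvalue (A + t *: const_mx 1) l ->
  (eigenspace (A + t *: const_mx 1) l
     :=: (map_mx (horner_eval l) (adj_ones A))^T)%MS.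
Proof.
move=> Asym lA lAt; set u := (map_mx _ _)^T.
have mE : map_mx (horner_eval l) (char_poly_mx A) = l%:M - A.
  by apply/matrixP => i j; rewrite !mxE /horner_eval !hornerE hornerMn hornerX.
have uE : u *m (l%:M - A) = (char_poly A).[l] *: const_mx 1.
  have /(congr1 (fun M => (map_mx (horner_eval l) M)^T)) := char_poly_mx_adj_ones A.
  rewrite map_mxM mE trmx_mul linearB /= tr_scalar_mx Asym => ->.
  by apply/matrixP => i j; rewrite !mxE !mulr1.
have al : (char_poly A).[l] != 0 by move: lA; rewrite eigenvalue_root_char.
have sub : (eigenspace (A + t *: const_mx 1) l <= u)%MS.
  apply/rV_subP => v /eigenspaceP vE.
  pose s := \sum_i v 0 i.
  have vE' : v *m (l%:M - A) = (t * s) *: const_mx 1.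
    rewrite mulmxBr mul_mx_scalar -vE mulmxDr addrAC subrr add0r -scalemxAr -scalerA.
    by congr (_ *: _); apply/matrixP => i j; rewrite ord1 !mxE mulr1;
      apply: eq_bigr => k _; rewrite mxE mulr1.
  have unitl : l%:M - A \in unitmx by rewrite unitmxE unitfE -mE det_map_mx.
  suff -> : v = ((char_poly A).[l]^-1 * (t * s)) *: u by exact: scalemx_sub.
  apply: (can_inj (mulmxK unitl)).
  by rewrite -scalemxAl uE vE' scalerA mulrAC mulVf // mul1r.
apply/eqmxP; rewrite sub /=.
have r1 : (0 < \rank (eigenspace (A + t *: const_mx 1)%R l))%N.
  by rewrite lt0n mxrank_eq0.
rewrite -(geq_leqif (mxrank_leqif_sup sub)).
exact: leq_trans (rank_leq_row _) r1.
Qed.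

Lemma lambda_min (R : realType) n (M : 'M[R]_n) : (0 < n)%N ->
  M \is symmetricmx ->
  eigenvalue M (lambda M n) /\ lambda M n * n%:R <= \tr M.
Proof.
move=> n0 Ms; have sz := size_eigenvalues Ms.
(* Index [n.-1] is in range, so [nth] does not return its default 0. *)
have mem : lambda M n \in eigenvalues M by rewrite mem_nth // sz; lia.
split; first by rewrite -mem_eigenvalues.
have -> : \tr M = \sum_(x <- eigenvalues M) x.
  apply: oppr_inj; rewrite -char_poly_trace // char_poly_eigenvalues //.
  by rewrite -coefPn_prod_XsubC sz //; lia.
have -> : lambda M n * n%:R = \sum_(x <- eigenvalues M) lambda M n.
  by rewrite big_const_seq count_predT sz iter_addr_0 mulr_natr.
rewrite big_seq [leRHS]big_seq; apply: ler_sum => x.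
case/(nthP 0) => i; rewrite sz => lt_i <-; rewrite /lambda.
have := sorted_eigenvalues M.
have tr : transitive (fun x y : R => y <= x)
  by move=> a b c ab bc; apply: le_trans bc ab.
move/(sorted_leq_nth tr (@lexx _ _) 0); apply; rewrite ?inE ?sz; lia.
Qed.

Theorem mainTheorem1 (R : realType) (n : nat) (A B : 'M[R]_n)
    (Sigma : 'I_n -> 'M[R]_n.-1) :
  (3 <= n)%N ->
  A \is symmetricmx -> B \is symmetricmx ->
  hypomorphism Sigma A B ->
  exists a b : R, a < b /\
    forall t : R, t \in `]a, b[ ->
      let At := A + t *: J R n in
      let Bt := B + t *: J R n in
      [/\ lambda At n = lambda Bt n,
          \rank (eigenspace At (lambda At n)) = 1%N /\
          \rank (eigenspace Bt (lambda Bt n)) = 1%N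
        & (eigenspace At (lambda At n) == eigenspace Bt (lambda Bt n))%MS].
Proof.
move=> n3 As Bs hyp; have n0 : (0 < n)%N by lia.
have Asym := symmetricmxE As; have Bsym := symmetricmxE Bs.
have [i|i|cAB uAB] := deck_char_poly_adj_ones n3 Asym Bsym.
- by have := hypomorphism_char_poly 0 i hyp; rewrite scale0r !addr0.
- by have := hypomorphism_char_poly (-1) i hyp; rewrite !scaleN1r.
(* For t < b the lowest eigenvalue, at most t + tr A / n, lies below [- cauchy_bound (char_poly A)],
   hence below every root of [char_poly A]. The length 1 of the interval is arbitrary. *)
pose b := - cauchy_bound (char_poly A) - \tr A / n%:R.
exists (b - 1), b; split; first by lra.
move=> t + At Bt; rewrite in_itv => /andP[_ tb].
have cABt : char_poly At = char_poly Bt.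
  by rewrite /At /Bt /J !char_poly_add_ones cAB uAB.
have lE : lambda At n = lambda Bt n by rewrite /lambda /eigenvalues cABt.
have Ats : At \is symmetricmx.
  apply/is_hermitianmxP; rewrite expr0 scale1r map_mx_id //.
  by rewrite linearD linearZ /= Asym trmx_const.
have [lAt lmin] := lambda_min n0 Ats.
have lBt : eigenvalue Bt (lambda At n).
  by rewrite eigenvalue_root_char -cABt -eigenvalue_root_char.
have lA : ~~ eigenvalue A (lambda At n).
  rewrite eigenvalue_root_char le_cauchy_bound ?char_poly_neq0 //.
  rewrite in_itv /=.
  have trE : \tr At = \tr A + t * n%:R.
    rewrite mxtraceD mxtraceZ; congr (_ + _ * _); rewrite /mxtrace.
    by under eq_bigr do rewrite mxE; rewrite sumr_const card_ord.
  suff : lambda At n <= \tr A / n%:R + t by move: tb; rewrite /b /=; lra.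
  have nR : 0 < n%:R :> R by rewrite ltr0n.
  by rewrite -(ler_pM2r nR) mulrDl divfK ?gt_eqF // -trE.
have lB : ~~ eigenvalue B (lambda At n).
  by rewrite eigenvalue_root_char -cAB -eigenvalue_root_char.
have eA := eigenspace_add_ones Asym lA lAt.
have eB := eigenspace_add_ones Bsym lB lBt.
have eAB : (eigenspace At (lambda At n) :=: eigenspace Bt (lambda At n))%MS.
  by apply: eqmx_trans eA _; rewrite uAB; apply: eqmx_sym.
have rA : \rank (eigenspace At (lambda At n)) = 1%N.
  apply/eqP; rewrite eqn_leq lt0n mxrank_eq0 {1}eA rank_leq_row.
  exact: lAt.
rewrite -lE; split => //; last exact/eqmxP.
by split; rewrite -?eAB.
Qed.
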